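(* Let $e\geq 2$ and let $\Gamma_e=VO^+(2e,2)$, realised on the set of all $2\times e$ matrices over $\mathbb{F}_2$. Let $W_1$ be the set of matrices whose second row is zero, and let $v$ be the matrix with entry $1$ in position $(2,e)$ and $0$ elsewhere. Define $V_1=\{x\in W_1: x_{1e}=1\}$, $V_2=\{x\in v+W_1: x_{1e}=0\}$, and let $C$ be the set of matrices $x$ with $x_{1e}=0$, $x_{2,e-1}=1$, $x_{2j}=0$ for all $j<e-1$ (the entries $x_{1j}$ for $j<e$ and $x_{2e}$ being arbitrary). Let $\Gamma_{e,2}$ be the graph obtained from $\Gamma_e$ by first switching the edges between $W_1$ and $v+W_1$, and then switching the edges between $V_1\cup V_2$ and $C$. Then $\Gamma_{e,2}$ is a strictly Neumaier graph that is edge-regular with parameters $$\bigl(2^{2e},\ (2^{e-1}+1)(2^e-1),\ 2(2^{e-2}+1)(2^{e-1}-1)\bigr)$$ and contains a $2^{e-1}$-regular $2^e$-clique. Further, with $\mu=2^{e-1}(2^{e-1}+1)$, the numbers of common neighbours of pairs of distinct non-adjacent vertices of $\Gamma_{e,2}$ take exactly the values $\mu-2^{e-1}$, $\mu$ and $\mu+2^{e-1}$.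
   Context: All graphs are finite, simple and undirected. For a $2\times e$ matrix $x=(x_{ij})$ over $\mathbb{F}_2$ define $Q(x)=\sum_{j=1}^{e} x_{1j}x_{2j}$ (the scalar product of its two rows). The affine polar graph $VO^+(2e,2)$ has vertex set the $2\times e$ matrices over $\mathbb{F}_2$, two distinct matrices $x,y$ adjacent iff $Q(x-y)=0$; it is strongly regular with parameters $(2^{2e},(2^{e-1}+1)(2^e-1),2(2^{e-2}+1)(2^{e-1}-1),2^{e-1}(2^{e-1}+1))$. For a set $X$ of matrices and a matrix $v$, $v+X=\{v+x:x\in X\}$. For disjoint vertex sets $S,T$ of a graph, switching the edges between $S$ and $T$ means: for each $x\in S$ and each $t\in T$, delete the edge $xt$ if present and insert it if absent. A graph on $v$ vertices is edge-regular with parameters $(v,k,\lambda)$ if it has at least one edge, is $k$-regular, and every two adjacent vertices have exactly $\lambda$ common neighbours; it is strongly regular if additionally it is non-complete and any two distinct non-adjacent vertices have a constant number of common neighbours. A clique $S$ in a regular graph is $m$-regular if every vertex outside $S$ is adjacent to exactly $m>0$ vertices of $S$. A strictly Neumaier graph is a non-complete edge-regular graph containing a regular clique which is not strongly regular. *)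

(* Defs.v *)
From mathcomp Require Import all_boot all_order all_algebra.

Set Implicit Arguments.
Unset Strict Implicit.
Unset Printing Implicit Defensive.

Import GRing.Theory.
Local Open Scope ring_scope.

Section Graphs.
Variable T : finType.
Implicit Types (G : rel T) (S U : {set T}).

Definition simple_graph G : Prop := symmetric G /\ irreflexive G.

Definition nbrs G x : {set T} := [set y | G x y].

Definition common_nbrs G x y : {set T} := nbrs G x :&: nbrs G y.

Definition complete_graph G : Prop := forall x y, x != y -> G x y.

Definition edge_regular G (v k l : nat) : Prop :=
  [/\ simple_graph G,
      #|T| = v,
      exists x y, G x y,
      forall x, #|nbrs G x| = k
    & forall x y, G x y -> #|common_nbrs G x y| = l].

Definition strongly_regular G : Prop :=
  [/\ exists v k l, edge_regular G v k l,
      ~ complete_graph G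
    & exists mu : nat, forall x y, x != y -> ~~ G x y ->
        #|common_nbrs G x y| = mu].

Definition clique G S : Prop :=
  forall x y, x \in S -> y \in S -> x != y -> G x y.

Definition regular_clique G (m : nat) S : Prop :=
  [/\ clique G S, (0 < m)%N
    & forall x, x \notin S -> #|nbrs G x :&: S| = m].

Definition strictly_Neumaier G : Prop :=
  [/\ exists v k l, edge_regular G v k l,
      ~ complete_graph G,
      exists m S, regular_clique G m S
    & ~ strongly_regular G].

(* Meant for disjoint S and U. *)
Definition switch S U G : rel T := fun x y =>
  G x y (+) ((x \in S) && (y \in U) || (x \in U) && (y \in S)).

End Graphs.

(* Rows and columns are numbered from 0: the entry written x_{ij} on paper is
   x (i-1) (j-1).  Column e is the j : 'I_e with j.+1 = e, and column e-1 the
   one with j.+2 = e. *)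
Section AffinePolar.
Variable e : nat.
Local Notation mat := 'M['F_2]_(2, e).

Definition Q (x : mat) : 'F_2 := \sum_(j < e) x 0 j * x 1 j.

Definition VOplus : rel mat := fun x y => (x != y) && (Q (x - y) == 0).

Definition W1 : {set mat} := [set x : mat | row 1 x == 0].

Definition vmat : mat := \matrix_(i, j) ((i == 1) && (j.+1 == e))%:R.

Definition translate (u : mat) (X : {set mat}) : {set mat} :=
  [set u + x | x in X].

Definition V1 : {set mat} :=
  [set x in W1 | [forall j : 'I_e, (j.+1 == e) ==> (x 0 j == 1)]].

Definition V2 : {set mat} :=
  [set x in translate vmat W1 |
    [forall j : 'I_e, (j.+1 == e) ==> (x 0 j == 0)]].

Definition Cset : {set mat} :=
  [set x : mat | [forall j : 'I_e,
    [&& (j.+1 == e) ==> (x 0 j == 0),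
        (j.+2 == e) ==> (x 1 j == 1)
      & (j.+2 < e)%N ==> (x 1 j == 0)]]].

Definition Gamma2 : rel mat :=
  switch (V1 :|: V2) Cset (switch W1 (translate vmat W1) VOplus).

End AffinePolar.

(* Main.v *)
Require Import Defs.
From mathcomp Require Import all_boot all_order all_algebra.
From mathcomp Require Import ring zify.

(* Record a graph by the signs M(x,z) = 1 if z = x or z ~ x, and -1 otherwise.
   When all rows of M have sum r, the number of common neighbours of x and y is
   determined by r, by M(x,y) and by the inner product of the rows x and y.  All
   these sums over z are evaluated with sign-reversing involutions that flip an
   entry of z: flipping z_{1j} multiplies (-1)^Q(x-z) by (-1)^(x_{2j}+z_{2j}),
   and flipping z_{2j} multiplies it by (-1)^(x_{1j}+z_{1j}).

   The first switching only depends on second rows, so rows of M stay pairwise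
   orthogonal.  In the second one, flipping z_{1j} with j < e preserves V1, V2
   and C, so two rows can only fail to be orthogonal if x and y have the same
   second row up to the last entry and exactly one of them lies in V1 u V2, or
   exactly one in C.  Their inner product is then -2 times a sum over C or over
   V1 u V2, which vanishes if x_{2e} = y_{2e}; otherwise its terms are all equal
   and x, y are not adjacent.  The regular clique is W1. *)

Set Implicit Arguments.
Unset Strict Implicit.
Unset Printing Implicit Defensive.

Import GRing.Theory.
Local Open Scope ring_scope.

(** * Sums of signs over finite sets *)

Lemma F2_cases (a : 'F_2) : a = 0 \/ a = 1.
Proof. by case: a => [[|[|m]] //= h]; [left|right]; apply: val_inj. Qed.

(** Reindexing by [f] turns the integer sum into its own negative. *)
Lemma sum_sign_involution (T : finType) (P h : pred T) (f : T -> T) :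
  involutive f -> (forall z, P (f z) = P z) ->
  (forall z, P z -> h (f z) = ~~ h z) ->
  \sum_(z | P z) (-1) ^+ h z = 0 :> int.
Proof.
move=> fK Pf hf; set s := LHS.
suff: s = - s by lia.
rewrite {1}/s (reindex_inj (inv_inj fK)) /= -sumrN.
by apply: eq_big => [z|z]; rewrite Pf // => /hf ->; case: (h z).
Qed.

Lemma sum_sign_const (T : finType) (P h : pred T) (b : bool) :
  (forall z, P z -> h z = b) ->
  \sum_(z | P z) (-1) ^+ h z = (-1) ^+ b * #|[set z | P z]|%:Z :> int.
Proof.
move=> hb; rewrite -sum1dep_card -natz natr_sum mulr_sumr.
by apply: eq_bigr => z /hb ->; rewrite mulr1.
Qed.

Lemma sum_sign_count (T : finType) (A : {set T}) (h : pred T) :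
  #|[set z in A | h z]|%:Z *+ 2
  = #|A|%:Z + \sum_(z in A) (-1) ^+ (~~ h z).
Proof.
rewrite -sum1dep_card -sum1_card -!natz !natr_sum -sumrMnl big_mkcondr /=.
by rewrite -big_split; apply: eq_bigr => z _ /=; case: (h z).
Qed.

(** * Neighbour counts from the sign matrix of a graph *)

Section Signs.
Variables (T : finType) (E : rel T).

(** This is the inner product of two rows of the sign matrix: the negations in the signs
    [(-1) ^+ (~~ E x z)] and [(-1) ^+ (~~ E y z)] cancel. *)
Definition sign_dot (x y : T) : int := \sum_z (-1) ^+ (E x z (+) E y z).

Lemma sign_dotC x y : sign_dot x y = sign_dot y x.
Proof. by apply: eq_bigr => z _; rewrite addbC. Qed.

Variables (G : rel T) (r : int).
Hypothesis E_refl : reflexive E.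
Hypothesis E_sym : symmetric E.
Hypothesis GE : forall x y, G x y = (x != y) && E x y.
Hypothesis E_sum : forall x, \sum_z (-1) ^+ (~~ E x z) = r.

Lemma nbrs_signs x : (#|nbrs G x|%:Z + 1) *+ 2 = #|T|%:Z + r.
Proof.
have -> : #|nbrs G x|%:Z + 1 = #|[set z in [set: T] | E x z]|%:Z.
  rewrite (cardsD1 x [set z in _ | _]) !inE E_refl addrC PoszD; congr (_ + _%:Z).
  by apply: eq_card => z; rewrite !inE GE eq_sym.
rewrite sum_sign_count cardsT -(E_sum x); congr (_ + _).
by apply: eq_bigl => z; rewrite !inE.
Qed.

(** For signs s and t, the indicator of s = t = 1 is (1 + s)(1 + t)/4; this is summed over [z]. As
    [E] is reflexive, adjacent [x] and [y] are themselves counted, hence the correction by 2. *)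
Lemma common_nbrs_signs x y : x != y ->
  (#|common_nbrs G x y|%:Z + (G x y)%:Z *+ 2) *+ 4
  = #|T|%:Z + r *+ 2 + sign_dot x y.
Proof.
move=> xy; set A := [set z | E x z && E y z].
have -> : #|common_nbrs G x y|%:Z + (G x y)%:Z *+ 2 = #|A|%:Z.
  rewrite (cardsD1 x A) (cardsD1 y (A :\ x)) !inE !E_refl (E_sym y x) eq_sym.
  rewrite xy GE xy /= andbT.
  have -> : #|(A :\ x) :\ y| = #|common_nbrs G x y|.
    apply: eq_card => z; rewrite !inE !GE (eq_sym x) (eq_sym y).
    by case: (z == x); case: (z == y) => //=; rewrite andbF.
  by rewrite !PoszD; ring.
rewrite -sum1dep_card -[Posz (\sum_(i | _) _)]natz natr_sum -sumrMnl big_mkcond /=.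
rewrite -[r *+ 2]/(r + r) -{1}(E_sum x) -(E_sum y) -sum1_card.
rewrite -[Posz (bigop _ _ _)]natz natr_sum.
rewrite -!big_split; apply: eq_bigr => z _ /=.
by case: (E x z); case: (E y z).
Qed.

End Signs.

(** * Coordinates for the switched sets and for adjacency *)

Section PolarGraph.
Variable n : nat.
Local Notation mat := 'M['F_2]_(2, n.+2).
(* l and p are the columns written e and e - 1 on paper. *)
Local Notation l := (ord_max : 'I_n.+2).
Let p : 'I_n.+2 := widen_ord (leqnSn n.+1) ord_max.
Implicit Types (x y z : mat) (j : 'I_n.+2).

Lemma p_neq_l : p != l.
Proof. by rewrite -val_eqE /= neq_ltn ltnSn. Qed.

(** Leaving out the last column makes this condition, like [tailp], invariant under flips of the
    last entry of the second row as well as under flips in the first row. *)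
Definition tail0 z := [forall j, (j != l) ==> (z 1 j == 0)].
Definition tailp z := [forall j, (j != l) ==> (z 1 j == (j == p)%:R)].

Lemma tail0P z : reflect (forall j, j != l -> z 1 j = 0) (tail0 z).
Proof.
by apply: (iffP forallP) => h j; [move/(implyP (h j))/eqP|apply/implyP=> /h/eqP].
Qed.

Lemma tailpP z : reflect (forall j, j != l -> z 1 j = (j == p)%:R) (tailp z).
Proof.
by apply: (iffP forallP) => h j; [move/(implyP (h j))/eqP|apply/implyP=> /h/eqP].
Qed.

Lemma tail0_tailp z : tail0 z -> tailp z = false.
Proof.
move/tail0P/(_ p p_neq_l) => h; apply/negP => /tailpP/(_ p p_neq_l).
by rewrite h eqxx => /eqP.
Qed.

Lemma in_W1 z : (z \in W1 n.+2) = tail0 z && (z 1 l == 0).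
Proof.
rewrite inE; apply/eqP/andP => [/rowP h|[/tail0P h /eqP hl]].
  by split; [apply/tail0P => j _; have := h j|have := h l]; rewrite !mxE // => ->.
by apply/rowP => j; rewrite !mxE; case: (eqVneq j l) => [->|/h].
Qed.

Lemma in_vW1 z :
  (z \in translate (vmat n.+2) (W1 n.+2)) = tail0 z && (z 1 l == 1).
Proof.
have -> : (z \in translate (vmat n.+2) (W1 n.+2)) = (z - vmat n.+2 \in W1 n.+2).
  apply/imsetP/idP => [[x xW ->]|h]; first by rewrite addrC addKr.
  by exists (z - vmat n.+2); rewrite // addrC subrK.
rewrite in_W1 !mxE !eqxx subr_eq0; congr (_ && _); apply: eq_forallb => j.
case: (eqVneq j l) => //= jl; rewrite !mxE eqxx (_ : j.+1 == n.+2 = false) ?subr0 //.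
by apply: contra_neqF jl => /eqP[jn]; apply: val_inj.
Qed.

Lemma last_forallb (P : pred 'I_n.+2) :
  [forall j : 'I_n.+2, (j.+1 == n.+2) ==> P j] = P l.
Proof.
apply/forallP/idP => [/(_ l)|Pl j]; first by rewrite eqxx.
by apply/implyP => /eqP[jn]; rewrite (_ : j = l) //; apply: val_inj.
Qed.

(** The last column is (1,0) on [V1] and (0,1) on [V2], so over F_2 the two cases merge into its
    entries being different. *)
Lemma in_V12 z : (z \in V1 n.+2 :|: V2 n.+2) = tail0 z && (z 0 l != z 1 l).
Proof.
rewrite in_setU [z \in V1 _]inE [z \in V2 _]inE !last_forallb in_W1 in_vW1.
case: (tail0 z) => //=.
by case: (F2_cases (z 0 l)) => ->; case: (F2_cases (z 1 l)) => ->.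
Qed.

Lemma in_Cset z : (z \in Cset n.+2) = tailp z && (z 0 l == 0).
Proof.
rewrite inE; apply/forallP/andP => [h|[/tailpP h /eqP hl] j].
  split; last by have /and3P[/implyP] := h l; rewrite eqxx => /(_ isT).
  apply/tailpP => j jl; have /and3P[_ /implyP h1 /implyP h2] := h j.
  have jn : (j <= n)%N.
    by move: jl (ltn_ord j); rewrite -(inj_eq val_inj) /=; lia.
  case: (eqVneq j p) => [jp|]; first by apply/eqP/h1; rewrite jp eqxx.
  rewrite -(inj_eq val_inj) /= => jp; apply/eqP/h2.
  by rewrite !ltnS ltn_neqAle jp.
have [->|jl] := eqVneq j l.
  by rewrite hl !eqxx /= (gtn_eqF (ltnSn _)) ltnNge leqnSn.
rewrite (h j jl) (_ : (j == p) = (nat_of_ord j == n)) // !eqSS.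
have jl' : (nat_of_ord j == n.+1) = false.
  by apply/negbTE; rewrite -(inj_eq val_inj) in jl.
by rewrite jl' /= !ltnS; case: (ltngtP j n).
Qed.

(* Second rows supported on the last column are those of W1 and v + W1. *)
Definition sw1 x z := [&& tail0 x, tail0 z & x 1 l != z 1 l].
Definition inV z := tail0 z && (z 0 l != z 1 l).
Definition inC z := tailp z && (z 0 l == 0).
Definition sw2 x z := inV x && inC z || inC x && inV z.
(* adj1 and adj2 are reflexive: x is related to x and to its neighbours after
   the first, resp. the second, switching. *)
Definition adj1 x z := (Q (x - z) == 0) (+) sw1 x z.
Definition adj2 x z := adj1 x z (+) sw2 x z.

(** The test [x != z] can stay outermost because neither switching touches the diagonal; for the
    second one, [tail0] and [tailp] exclude each other. *)
Lemma Gamma2E x z : @Gamma2 n.+2 x z = (x != z) && adj2 x z.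
Proof.
rewrite /Gamma2 /switch /VOplus !in_V12 !in_Cset !in_W1 !in_vW1.
rewrite /adj2 /adj1 /sw2 /inV /inC.
have -> : (tail0 x && (x 1 l == 0) && (tail0 z && (z 1 l == 1))
  || tail0 x && (x 1 l == 1) && (tail0 z && (z 1 l == 0))) = sw1 x z.
  rewrite /sw1; case: (tail0 x) => //=; case: (tail0 z); rewrite /= ?andbF //.
  by case: (F2_cases (x 1 l)) => ->; case: (F2_cases (z 1 l)) => ->.
case: (eqVneq x z) => [->|//]; rewrite /sw1 eqxx !andbF /=.
by case h: (tail0 z); rewrite ?(tail0_tailp h) //= andbF.
Qed.

Lemma sw1C x z : sw1 x z = sw1 z x.
Proof. by rewrite /sw1 andbCA eq_sym. Qed.

Lemma QN z : Q (- z) = Q z.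
Proof. by apply: eq_bigr => j _; rewrite !mxE mulrNN. Qed.

Lemma adj2_sym : symmetric adj2.
Proof.
move=> x z; rewrite /adj2 /adj1 sw1C -opprB QN /sw2; congr (_ (+) _).
by rewrite orbC; congr (_ || _); rewrite andbC.
Qed.

Lemma adj2_refl : reflexive adj2.
Proof.
move=> z; rewrite /adj2 /adj1 subrr /sw1 eqxx !andbF /sw2 /Q big1 => [|j _].
  by rewrite eqxx /= /inV /inC; case h: (tail0 z); rewrite ?(tail0_tailp h) //= andbF.
by rewrite !mxE mul0r.
Qed.

(** * Flipping one entry of a matrix *)

Definition flip (i : 'I_2) j z : mat := z + delta_mx i j.

Lemma flipE i j z i' j' :
  flip i j z i' j' = z i' j' + ((i' == i) && (j' == j))%:R.
Proof. by rewrite !mxE. Qed.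

Lemma flipK i j : involutive (flip i j).
Proof.
move=> z; apply/matrixP => i' j'; rewrite !flipE.
by case: (_ && _); case: (F2_cases (z i' j')) => ->; apply/eqP.
Qed.

(** Column [j] contributes the product of its two entries to [Q], so changing one of them adds the
    other; [1 - i] is the other row. *)
Lemma Q_flip i j x z :
  (Q (x - flip i j z) == 0)
  = (Q (x - z) == 0) (+) (x (1 - i) j != z (1 - i) j).
Proof.
have -> : Q (x - flip i j z) = Q (x - z) + (x (1 - i) j - z (1 - i) j).
  rewrite /Q (bigD1 j) //= [in RHS](bigD1 j) //=.
  rewrite [RHS]addrAC; congr (_ + _); last first.
    by apply: eq_bigr => k kj; rewrite !mxE (negbTE kj) !andbF !addr0.
  rewrite !mxE eqxx !andbT.
  have: i = 0 \/ i = 1.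
    by case: i => [[|[|i]] //= hi]; [left|right]; apply: val_inj.
  case=> ->; rewrite ?subr0 ?subrr /=;
  by case: (F2_cases (x 0 j)) => ->; case: (F2_cases (z 0 j)) => ->;
     case: (F2_cases (x 1 j)) => ->; case: (F2_cases (z 1 j)) => ->; apply/eqP.
case: (F2_cases (Q (x - z))) => ->;
by case: (F2_cases (x (1 - i) j)) => ->; case: (F2_cases (z (1 - i) j)) => ->.
Qed.

Lemma Q_flip0 j x z :
  (Q (x - flip 0 j z) == 0) = (Q (x - z) == 0) (+) (x 1 j != z 1 j).
Proof. by rewrite (Q_flip 0 j x z) subr0. Qed.

Lemma Q_flip1 j x z :
  (Q (x - flip 1 j z) == 0) = (Q (x - z) == 0) (+) (x 0 j != z 0 j).
Proof. by rewrite (Q_flip 1 j x z) subrr. Qed.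

Lemma flip0_row j z k : flip 0 j z 1 k = z 1 k.
Proof. by rewrite flipE addr0. Qed.

Lemma tail0_flip0 j z : tail0 (flip 0 j z) = tail0 z.
Proof. by apply/eq_forallb => k; rewrite flip0_row. Qed.

Lemma tailp_flip0 j z : tailp (flip 0 j z) = tailp z.
Proof. by apply/eq_forallb => k; rewrite flip0_row. Qed.

Lemma tail0_flipl z : tail0 (flip 1 l z) = tail0 z.
Proof.
by apply/eq_forallb => k; rewrite flipE; case: eqVneq => //= _; rewrite addr0.
Qed.

Lemma tailp_flipl z : tailp (flip 1 l z) = tailp z.
Proof.
by apply/eq_forallb => k; rewrite flipE; case: eqVneq => //= _; rewrite addr0.
Qed.

Lemma adj1_flip0 j x z : adj1 x (flip 0 j z) = adj1 x z (+) (x 1 j != z 1 j).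
Proof. by rewrite /adj1 /sw1 Q_flip0 tail0_flip0 flip0_row addbAC. Qed.

Lemma inV_flip0 j z : j != l -> inV (flip 0 j z) = inV z.
Proof.
by move=> jl; rewrite /inV tail0_flip0 !flipE (eq_sym l) (negbTE jl) /= !addr0.
Qed.

Lemma inC_flip0 j z : j != l -> inC (flip 0 j z) = inC z.
Proof.
by move=> jl; rewrite /inC tailp_flip0 !flipE (eq_sym l) (negbTE jl) /= !addr0.
Qed.

Lemma adj2_flip0 j x z : j != l ->
  adj2 x (flip 0 j z) = adj2 x z (+) (x 1 j != z 1 j).
Proof.
by move=> jl; rewrite /adj2 /sw2 adj1_flip0 inV_flip0 // inC_flip0 // addbAC.
Qed.

Local Ltac F2case a := case: (F2_cases a) => ->.

(** * Second rows that agree off the last column *)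

Definition same_tail x z := [forall j, (j != l) ==> (z 1 j == x 1 j)].

Lemma same_tailP x z :
  reflect (forall j, j != l -> z 1 j = x 1 j) (same_tail x z).
Proof.
by apply: (iffP forallP) => h j; [move/(implyP (h j))/eqP|apply/implyP=> /h/eqP].
Qed.

Lemma same_tailC x z : same_tail x z = same_tail z x.
Proof. by apply/eq_forallb => j; rewrite [z 1 j == _]eq_sym. Qed.

Lemma same_tailPn x z :
  reflect (exists2 j, j != l & z 1 j != x 1 j) (~~ same_tail x z).
Proof.
rewrite negb_forall; apply: (iffP existsP) => [[j]|[j jl h]].
  by rewrite negb_imply => /andP[]; exists j.
by exists j; rewrite negb_imply jl.
Qed.

Lemma same_tail0 x z : same_tail x z -> tail0 z = tail0 x.
Proof.
move/same_tailP => h; apply/eq_forallb => j.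
by case: (eqVneq j l) => //= jl; rewrite h.
Qed.

Lemma same_tailp x z : same_tail x z -> tailp z = tailp x.
Proof.
move/same_tailP => h; apply/eq_forallb => j.
by case: (eqVneq j l) => //= jl; rewrite h.
Qed.

(** The two sets of the second switching lie in different classes of [same_tail], so nothing is
    switched inside a class. *)
Lemma sw2_same_tail x z : same_tail x z -> sw2 x z = false.
Proof.
move=> h; rewrite /sw2 /inV /inC (same_tail0 h) (same_tailp h).
by case t: (tail0 x); rewrite ?(tail0_tailp t) //= ?andbF.
Qed.

(** * Sizes of the switched sets *)

Lemma card_row1 (d : 'rV['F_2]_n.+2) :
  #|[set z : mat | row 1 z == d]| = (2 ^ n.+2)%N.
Proof.
pose f (a : 'rV['F_2]_n.+2) : mat :=
  \matrix_(i, j) (if i == 0 then a 0 j else d 0 j).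
have f_inj : injective f.
  by move=> a b /matrixP ab; apply/rowP => j; have := ab 0 j; rewrite !mxE.
rewrite -[RHS](_ : #|f @: setT| = _); last first.
  by rewrite card_imset // cardsT card_mx card_Fp // mul1n.
apply: eq_card => z; rewrite !inE; apply/eqP/imsetP => [zd|[a _ ->]].
  exists (row 0 z) => //; apply/matrixP => i j; rewrite !mxE.
  case: (eqVneq i 0) => [->//|i0]; rewrite -zd mxE; congr (z _ _).
  by case: i i0 => [[|[|i]] //= hi] _; apply: val_inj.
by apply/rowP => j; rewrite !mxE.
Qed.

Lemma card_W1 : #|W1 n.+2| = (2 ^ n.+2)%N.
Proof. exact: card_row1. Qed.

Lemma card_inV : #|[set z | inV z]| = (2 ^ n.+2)%N.
Proof.
(* This involution matches [inV] with [W1]: it leaves the last column (1,0) alone and turns (0,1)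
   into (0,0). *)
pose f z := if z 0 l == 0 then flip 1 l z else z.
have fK : involutive f.
  move=> z; rewrite /f; case h: (z 0 l == 0); last by rewrite h.
  by rewrite flipE addr0 h flipK.
rewrite -card_W1 -[RHS](on_card_preimset (onW_bij _ (inv_bij fK))).
apply: eq_card => z; rewrite [LHS]inE.
rewrite [RHS](_ : _ = (f z \in W1 n.+2)); last by rewrite !inE.
rewrite in_W1 /inV /f.
case: ifP => [/eqP ->|]; last by F2case (z 0 l) => // _; F2case (z 1 l).
by rewrite tail0_flipl flipE !eqxx; F2case (z 1 l).
Qed.

Lemma card_inC : #|[set z | inC z]| = (2 ^ n.+2)%N.
Proof.
(* g swaps the two entries of the last column. *)
pose g z : mat := \matrix_(i, j) z (if j == l then 1 - i else i) j.
have gK : involutive g.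
  by move=> z; apply/matrixP => i j; rewrite !mxE; case: eqP => // _; rewrite subKr.
(* The swap moves the condition on [z 0 l] to the second row, where [W1] has it, and the flip at [p]
   clears the 1 prescribed by [tailp]. *)
have fK : bijective (flip 1 p \o g).
  by apply: bij_comp; [apply: inv_bij (flipK _ _)|apply: inv_bij].
rewrite -card_W1 -[RHS](on_card_preimset (onW_bij _ fK)).
apply: eq_card => z; rewrite [LHS]inE.
rewrite [RHS](_ : _ = (flip 1 p (g z) \in W1 n.+2)); last by rewrite !inE.
rewrite in_W1 /inC flipE (eq_sym l) (negbTE p_neq_l) !mxE eqxx subrr addr0.
congr (_ && _).
apply/eq_forallb => j; rewrite flipE mxE; case: (eqVneq j l) => //= _.
by case: (j == p) => /=; F2case (z 1 j).
Qed.

(** * Row sums and orthogonality of rows *)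

(** The [z] whose tail differs from that of [x] cancel by a flip in the first row off the last
    column. Those with the same tail but another last entry cancel by flipping [z 0 l]. What remains
    are the [z] with the same second row as [x], all with sign 1. *)
Lemma adj2_sum x : \sum_z (-1) ^+ (~~ adj2 x z) = (2 ^ n.+2)%N%:Z.
Proof.
(* f flips the first row at a column that depends only on the second row. *)
pose f z :=
  if [pick j | (j != l) && (z 1 j != x 1 j)] is Some j then flip 0 j z else z.
have f_row z j : f z 1 j = z 1 j.
  by rewrite /f; case: pickP => [k _|//]; rewrite flip0_row.
rewrite (bigID (fun z => same_tail x z)) /=.
rewrite [X in _ + X](@sum_sign_involution _ _ _ f).
- rewrite addr0 (bigID (fun z => z 1 l == x 1 l)) /=.
  rewrite [X in _ + X](@sum_sign_involution _ _ _ (flip 0 l)).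
  + rewrite addr0 -(card_row1 (row 1 x)) -sum1dep_card -natz natr_sum.
    apply: eq_big => [z|z /andP[zx zl]].
      apply/andP/eqP => [[/same_tailP h /eqP hl]|h].
        by apply/rowP => j; rewrite !mxE; case: (eqVneq j l) => [->|/h].
      have {}h j : z 1 j = x 1 j by move/rowP/(_ j): h; rewrite !mxE.
      by rewrite h eqxx; split=> //; apply/same_tailP => j _.
    rewrite /adj2 sw2_same_tail // /adj1 /sw1 [x 1 l == _]eq_sym zl !andbF /= !addbF.
    rewrite (_ : Q _ = 0) // /Q big1 // => j _; rewrite !mxE.
    move/same_tailP: zx => zx; rewrite (_ : z 1 j = x 1 j) ?subrr ?mulr0 //.
    by case: (eqVneq j l) => [->|/zx//]; apply/eqP.
  + exact: flipK.
  + move=> z; rewrite flip0_row; congr (_ && _).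
    by apply/eq_forallb => j; rewrite flip0_row.
  + move=> z /andP[zx zl].
    have zx' : same_tail x (flip 0 l z).
      by apply/same_tailP => j jl; rewrite flip0_row; apply: (same_tailP _ _ zx).
    rewrite /adj2 !sw2_same_tail // adj1_flip0 eq_sym zl !addbF.
    by case: (adj1 x z).
- move=> z; rewrite {1}/f (@eq_pick _ _ (fun j => (j != l) && (z 1 j != x 1 j))).
    by rewrite /f; case: pickP => [j _|//]; rewrite flipK.
  by move=> j; rewrite /= f_row.
- by move=> z; congr (~~ _); apply/eq_forallb => j; rewrite f_row.
- move=> z /same_tailPn[k kl kx]; rewrite /f; case: pickP => [j /andP[jl jx]|/(_ k)].
    by rewrite adj2_flip0 // eq_sym jx addbT.
  by rewrite /= kl kx.
Qed.

(** In a column where the second rows of [x] and [y] differ, [z] agrees with exactly one of them, so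
    flipping its upper entry there changes exactly one of the two signs. *)
Lemma sign_dot_tail x y : ~~ same_tail x y -> sign_dot adj2 x y = 0.
Proof.
case/same_tailPn => j jl xy.
apply: (sum_sign_involution (flipK 0 j)) => // z _; rewrite !adj2_flip0 //.
move: xy; F2case (x 1 j); F2case (y 1 j); F2case (z 1 j) => // _;
by case: (adj2 x z); case: (adj2 y z).
Qed.

(** If the second rows differ, an upper entry of [z] is flipped, the last column being allowed here.
    If they agree, the first switching cancels out of the product and a lower entry is flipped where
    the first rows differ. *)
Lemma sign_dot_adj1 x y : x != y -> sign_dot adj1 x y = 0.
Proof.
move=> xy; case: (pickP (fun j => x 1 j != y 1 j)) => [j|row1].
  move=> xyj; apply: (sum_sign_involution (flipK 0 j)) => // z _.
  rewrite !adj1_flip0; move: xyj.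
  F2case (x 1 j); F2case (y 1 j); F2case (z 1 j) => // _;
  by case: (adj1 x z); case: (adj1 y z).
have {}row1 j : y 1 j = x 1 j by apply/eqP; have /negbFE := row1 j; rewrite eq_sym.
have t0 : tail0 y = tail0 x by apply/eq_forallb => j; rewrite row1.
have [j xyj] : exists j, x 0 j != y 0 j.
  apply/existsP; apply: contraNT xy; rewrite negb_exists => /forallP h.
  apply/eqP/matrixP => i j.
  have [->|->] : i = 0 \/ i = 1.
    by case: i => [[|[|i]] //= hi]; [left|right]; apply: val_inj.
    by apply/eqP; rewrite -[_ == _]negbK h.
  by rewrite row1.
have adjE z : adj1 x z (+) adj1 y z = (Q (x - z) == 0) (+) (Q (y - z) == 0).
  rewrite /adj1 /sw1 t0 row1; case: (Q _ == 0); case: (Q _ == 0) => //=;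
  by case: [&& _, _ & _].
rewrite /sign_dot; under eq_bigr do rewrite adjE.
apply: (sum_sign_involution (flipK 1 j)) => // z _.
rewrite (Q_flip1 j x z) (Q_flip1 j y z); move: xyj.
F2case (x 0 j); F2case (y 0 j); F2case (z 0 j) => // _;
by case: (Q (x - z) == 0); case: (Q (y - z) == 0).
Qed.

(** Subtracting the zero inner product for [adj1] leaves the [z] at which the second switching
    changes exactly one of the two signs; there the difference is -2 times the old term. *)
Lemma sign_dot_switch x y : x != y ->
  sign_dot adj2 x y
  = - 2 * \sum_(z | sw2 x z (+) sw2 y z) (-1) ^+ (adj1 x z (+) adj1 y z).
Proof.
move=> xy; transitivity (sign_dot adj2 x y - sign_dot adj1 x y).
  by rewrite sign_dot_adj1 // subr0.
rewrite mulr_sumr -sumrB [RHS]big_mkcond /=; apply: eq_bigr => z _; rewrite /adj2.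
by case: (adj1 x z); case: (adj1 y z); case: (sw2 x z); case: (sw2 y z).
Qed.

(** * Inner products of rows that the second switching separates *)

Lemma Q_same_tail x y : same_tail x y ->
  Q (x - y) = (x 0 l - y 0 l) * (x 1 l - y 1 l).
Proof.
move/same_tailP => xy; rewrite /Q (bigD1 l) //= big1 ?addr0 ?mxE // => j jl.
by rewrite !mxE xy // subrr mulr0.
Qed.

(** Besides the last column only column [p] contributes, and there [z 0 p] cancels over F_2. The
    hypothesis on [z] serves both for [tail0] against [tailp] and for the reverse. *)
Lemma Q_add_same_tail x y z : same_tail x y ->
  (forall j, j != l -> z 1 j = x 1 j + (j == p)%:R) ->
  Q (x - z) + Q (y - z) = x 0 p + y 0 p
    + ((x 0 l - z 0 l) * (x 1 l - z 1 l) + (y 0 l - z 0 l) * (y 1 l - z 1 l)).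
Proof.
move/same_tailP => xy zx; rewrite /Q -big_split (bigD1 l) //= addrC.
rewrite (bigD1 p) ?p_neq_l //= big1 ?addr0 => [|j /andP[jl jp]].
  rewrite !mxE (xy p p_neq_l) (zx p p_neq_l) eqxx; congr (_ + _).
  by F2case (x 0 p); F2case (y 0 p); F2case (z 0 p); F2case (x 1 p); apply/eqP.
rewrite !mxE xy ?zx // (negbTE jp).
by F2case (x 0 j); F2case (y 0 j); F2case (z 0 j); F2case (x 1 j); apply/eqP.
Qed.

Local Notation N := (2 ^ n.+2)%N.

Lemma Q_eq0_addb x y z (a : 'F_2) : Q (x - z) + Q (y - z) = a ->
  (Q (x - z) == 0) (+) (Q (y - z) == 0) = (a == 1).
Proof. by move<-; F2case (Q (x - z)); F2case (Q (y - z)). Qed.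

Lemma sign_dot_V x y : same_tail x y -> inV x -> ~~ inV y ->
  sign_dot adj2 x y
  = if x 1 l == y 1 l then 0
    else - 2 * ((-1) ^+ (x 0 p + y 0 p + x 0 l == 1) * N%:Z).
Proof.
move=> xy Vx Vy; have xNy : x != y by apply: contraTneq Vx => ->.
have [tx xl] := andP Vx; have ty : tail0 y by rewrite (same_tail0 xy).
have Cx : inC x = false by rewrite /inC tail0_tailp.
have Cy : inC y = false by rewrite /inC tail0_tailp.
have yl : y 0 l = y 1 l by move: Vy; rewrite /inV ty negbK => /eqP.
rewrite sign_dot_switch //.
have swE z : sw2 x z (+) sw2 y z = inC z.
  by rewrite /sw2 Vx Cx Cy (negbTE Vy) /= orbF addbF.
have adjE z : inC z ->
    adj1 x z (+) adj1 y z = (Q (x - z) == 0) (+) (Q (y - z) == 0).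
  case/andP=> tz _; rewrite /adj1 /sw1.
  have -> : tail0 z = false by apply: contraTF tz => /tail0_tailp ->.
  by rewrite !andbF !addbF.
rewrite (eq_bigl _ _ swE); case: eqP => [xyl|/eqP xyl].
  (* Here [x 0 l] and [y 0 l] differ, so flipping [z 1 l], which is free in [C], changes exactly one
     sign. *)
  rewrite (@sum_sign_involution _ _ _ (flip 1 l)) ?mulr0 //.
  - exact: flipK.
  - by move=> z; rewrite /inC tailp_flipl flipE addr0.
  move=> z Cz; have Cz' : inC (flip 1 l z) by rewrite /inC tailp_flipl flipE addr0.
  rewrite !adjE // (Q_flip1 l x z) (Q_flip1 l y z); move: xl xyl yl.
  F2case (x 1 l); F2case (y 1 l) => // + _ ->;
  F2case (x 0 l); F2case (z 0 l) => // _;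
  by case: (Q (x - z) == 0); case: (Q (y - z) == 0).
(* Now [x 0 l = y 0 l], and since [z 0 l = 0] the last column gives
   [x 0 l * (x 1 l - y 1 l) = x 0 l], whatever [z 1 l] is. *)
rewrite (@sum_sign_const _ _ _ (x 0 p + y 0 p + x 0 l == 1)) ?card_inC // => z Cz.
rewrite adjE //; apply: Q_eq0_addb.
have /andP[/tailpP tz /eqP zl] := Cz.
rewrite Q_add_same_tail // => [|j jl]; last first.
  by rewrite (tail0P _ tx) // tz // add0r.
congr (_ + _); rewrite zl yl; move: xl xyl.
F2case (x 0 l); F2case (x 1 l); F2case (y 1 l); F2case (z 1 l) => // _ _;
by apply/eqP.
Qed.

(** In either case [Q (x - y)] is 0; when the last entries of the second rows differ, the first
    switching removes the edge. *)
Lemma adj2_V x y : same_tail x y -> inV x -> ~~ inV y ->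
  adj2 x y = (x 1 l == y 1 l).
Proof.
move=> xy Vx Vy; have [tx xl] := andP Vx.
have ty : tail0 y by rewrite (same_tail0 xy).
have yl : y 0 l = y 1 l by move: Vy; rewrite /inV ty negbK => /eqP.
rewrite /adj2 sw2_same_tail // /adj1 /sw1 tx ty Q_same_tail // yl; move: xl.
by F2case (x 0 l); F2case (x 1 l); F2case (y 1 l).
Qed.

Lemma sign_dot_C x y : same_tail x y -> inC x -> ~~ inC y ->
  sign_dot adj2 x y
  = if x 1 l == y 1 l then 0
    else - 2 * ((-1) ^+ (x 0 p + y 0 p + x 1 l == 1) * N%:Z).
Proof.
move=> xy Cx Cy; have xNy : x != y by apply: contraTneq Cx => ->.
have [tx /eqP xl] := andP Cx; have ty : tailp y by rewrite (same_tailp xy).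
have tx0 : tail0 x = false by apply: contraTF tx => /tail0_tailp ->.
have ty0 : tail0 y = false by apply: contraTF ty => /tail0_tailp ->.
have yl : y 0 l = 1.
  by move: Cy; rewrite /inC ty; F2case (y 0 l).
rewrite sign_dot_switch //.
have swE z : sw2 x z (+) sw2 y z = inV z.
  by rewrite /sw2 Cx (negbTE Cy) /inV tx0 ty0 /= addbF.
have adjE z : adj1 x z (+) adj1 y z = (Q (x - z) == 0) (+) (Q (y - z) == 0).
  by rewrite /adj1 /sw1 tx0 ty0 !addbF.
under eq_bigr do rewrite adjE.
rewrite (eq_bigl _ _ swE); case: eqP => [xyl|/eqP xyl].
  (* A single flip in the last column would break [inV]; flipping both its entries keeps them
     different. *)
  rewrite (@sum_sign_involution _ _ _ (fun z => flip 0 l (flip 1 l z))) ?mulr0 //.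
  - by move=> z; rewrite {3}/flip addrAC -/(flip 0 l _) -/(flip 1 l z) flipK flipK.
  - move=> z; rewrite /inV tail0_flip0 tail0_flipl !flipE eqxx /=.
    by F2case (z 0 l); F2case (z 1 l).
  move=> z _; rewrite (Q_flip0 l x) (Q_flip0 l y) (Q_flip1 l x z) (Q_flip1 l y z).
  rewrite !flipE !eqxx /= xl yl xyl.
  F2case (y 1 l); F2case (z 0 l); F2case (z 1 l) => /=;
  by case: (Q (x - z) == 0); case: (Q (y - z) == 0).
(* With [x 0 l = 0], [y 0 l = 1] and unequal entries in the last column of [z], that column
   contributes [x 1 l] independently of [z]. *)
rewrite (@sum_sign_const _ _ _ (x 0 p + y 0 p + x 1 l == 1)) ?card_inV // => z.
case/andP=> /tail0P tz zl; apply: Q_eq0_addb.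
rewrite Q_add_same_tail // => [|j jl]; last first.
  by rewrite (tailpP _ tx) // tz //; case: (j == p); apply/eqP.
congr (_ + _); rewrite xl yl; move: zl xyl.
F2case (z 0 l); F2case (x 1 l); F2case (y 1 l); F2case (z 1 l) => // _ _;
by apply/eqP.
Qed.

(** Neither switching affects this pair, and [x 0 l = 0], [y 0 l = 1] give
    [Q (x - y) = x 1 l - y 1 l] over F_2. *)
Lemma adj2_C x y : same_tail x y -> inC x -> ~~ inC y ->
  adj2 x y = (x 1 l == y 1 l).
Proof.
move=> xy Cx Cy; have [tx /eqP xl] := andP Cx.
have ty : tailp y by rewrite (same_tailp xy).
have tx0 : tail0 x = false by apply: contraTF tx => /tail0_tailp ->.
have yl : y 0 l = 1.
  by move: Cy; rewrite /inC ty; F2case (y 0 l).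
rewrite /adj2 sw2_same_tail // /adj1 /sw1 tx0 Q_same_tail // xl yl.
by F2case (x 1 l); F2case (y 1 l).
Qed.

Lemma sign_dot_same x y : x != y -> inV x = inV y -> inC x = inC y ->
  sign_dot adj2 x y = 0.
Proof.
move=> xy V C; rewrite sign_dot_switch // big_pred0 ?mulr0 // => z.
by rewrite /sw2 V C addbb.
Qed.

(** Edge-regularity rests on this: a nonzero inner product occurs only for non-adjacent pairs, so it
    can alter mu but not lambda. *)
Lemma sign_dot_adj2 x y : x != y ->
  sign_dot adj2 x y = 0 \/
  ~~ adj2 x y /\
  (sign_dot adj2 x y = 2 * N%:Z \/ sign_dot adj2 x y = - (2 * N%:Z)).
Proof.
move=> xy; have [st|/sign_dot_tail ->] := boolP (same_tail x y); last by left.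
have valE (b : bool) :
    - 2 * ((-1) ^+ b * N%:Z) = 2 * N%:Z \/
    - 2 * ((-1) ^+ b * N%:Z) = - (2 * N%:Z).
  case: b; [left|right]; first by rewrite expr1 mulN1r mulrNN.
  by rewrite expr0 mul1r mulNr.
have sep u w : same_tail u w -> (inV u && ~~ inV w) || (inC u && ~~ inC w) ->
    sign_dot adj2 u w = 0 \/ ~~ adj2 u w /\
    (sign_dot adj2 u w = 2 * N%:Z \/ sign_dot adj2 u w = - (2 * N%:Z)).
  move=> uw /orP[] /andP[u_in w_out].
    by rewrite sign_dot_V // adj2_V //; case: eqP => _; [left|right; split].
  by rewrite sign_dot_C // adj2_C //; case: eqP => _; [left|right; split].
have [/sep|/norP[Vxy Cxy]] := boolP ((inV x && ~~ inV y) || (inC x && ~~ inC y)).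
  exact.
have [h|/norP[Vyx Cyx]] := boolP ((inV y && ~~ inV x) || (inC y && ~~ inC x)).
  by rewrite sign_dotC adj2_sym; apply: sep; rewrite // same_tailC.
left; apply: sign_dot_same => //.
  by move: Vxy Vyx; case: (inV x); case: (inV y).
by move: Cxy Cyx; case: (inC x); case: (inC y).
Qed.

(** * The regular clique *)

Lemma W1_clique : clique (@Gamma2 n.+2) (W1 n.+2).
Proof.
move=> x y; rewrite !in_W1 Gamma2E.
move=> /andP[/tail0P tx /eqP xl] /andP[/tail0P ty /eqP yl] ->.
have xy : same_tail x y by apply/same_tailP => j jl; rewrite tx // ty.
rewrite /adj2 sw2_same_tail // /adj1 Q_same_tail // /sw1 xl yl subrr mulr0.
by rewrite eqxx !andbF.
Qed.

(** Flips in the first row preserve [W1], and the sign changes in any usable column where the second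
    row of [x] is nonzero. The last column is used only if [tail0 x] holds; then [x] has the same
    tail as [W1] and the second switching is absent. *)
Lemma W1_adj2_sum x : x \notin W1 n.+2 ->
  \sum_(z in W1 n.+2) (-1) ^+ (~~ adj2 x z) = 0 :> int.
Proof.
rewrite in_W1 negb_and => xW.
have W1_flip j z : (flip 0 j z \in W1 n.+2) = (z \in W1 n.+2).
  by rewrite !in_W1 tail0_flip0 flip0_row.
have [tx|] := boolP (tail0 x); last first.
  rewrite negb_forall => /existsP[j]; rewrite negb_imply => /andP[jl xj].
  apply: (sum_sign_involution (flipK 0 j)) => // z.
  by rewrite in_W1 => /andP[/tail0P tz _]; rewrite adj2_flip0 // tz // xj addbT.
move: xW; rewrite tx /= => xl.
apply: (sum_sign_involution (flipK 0 l)) => // z zW.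
have st w : w \in W1 n.+2 -> same_tail x w.
  rewrite in_W1 => /andP[/tail0P tw _]; apply/same_tailP => j jl.
  by rewrite tw // (tail0P _ tx).
rewrite /adj2 !sw2_same_tail ?st ?W1_flip // !addbF adj1_flip0.
by move: zW; rewrite in_W1 => /andP[_ /eqP ->]; rewrite xl addbT.
Qed.

Lemma W1_regular_clique : regular_clique (@Gamma2 n.+2) (2 ^ n.+1)%N (W1 n.+2).
Proof.
split; [exact: W1_clique|by rewrite expn_gt0|move=> x xW].
have := sum_sign_count (W1 n.+2) (adj2 x); rewrite W1_adj2_sum // addr0 card_W1.
rewrite (_ : [set z in _ | _] = nbrs (@Gamma2 n.+2) x :&: W1 n.+2).
  by rewrite expnS; move: #|_ :&: _| (2 ^ n.+1)%N => a b; lia.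
apply/setP => z; rewrite in_setI [LHS]in_set [z \in nbrs _ _]in_set Gamma2E andbC.
case zW: (z \in _); rewrite ?andbF // !andbT (_ : x != z) //.
by apply: contraNneq xW => ->.
Qed.

(** * Valency and numbers of common neighbours *)

Lemma card_mat : #|{: mat}| = (2 ^ (2 * n.+2))%N.
Proof. by rewrite card_mx card_Fp. Qed.

Lemma Gamma2_nbrs x :
  #|nbrs (@Gamma2 n.+2) x| = ((2 ^ n.+1 + 1) * (2 ^ n.+2 - 1))%N.
Proof.
have := nbrs_signs adj2_refl Gamma2E adj2_sum x.
rewrite card_mat mulnC expnM !expnS expn0; have := expn_gt0 2 n.
by move: (2 ^ n)%N => a; nia.
Qed.

(** The row sum being 2^e, the constant is 2^(2e) + 2 * 2^e, which is four times mu. *)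
Lemma Gamma2_common x y : x != y ->
  (#|common_nbrs (@Gamma2 n.+2) x y|%:Z + (Gamma2 x y)%:Z *+ 2) *+ 4
  = (2 ^ n.+1 * (2 ^ n.+1 + 1) * 4)%N%:Z + sign_dot adj2 x y.
Proof.
move=> xy; rewrite (common_nbrs_signs adj2_refl adj2_sym Gamma2E adj2_sum xy).
rewrite card_mat; congr (_ + _); rewrite mulnC expnM !expnS expn0.
by move: (2 ^ n)%N => a; nia.
Qed.

(** The inner product vanishes on edges, so the count is mu - 2, which factors as stated. *)
Lemma Gamma2_lambda x y : Gamma2 x y ->
  #|common_nbrs (@Gamma2 n.+2) x y| = (2 * (2 ^ n + 1) * (2 ^ n.+1 - 1))%N.
Proof.
move=> Gxy; have := Gxy; rewrite Gamma2E => /andP[xy Exy].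
have := Gamma2_common xy; case: (sign_dot_adj2 xy) => [->|[]]; last by rewrite Exy.
rewrite Gxy addr0 !expnS; have := expn_gt0 2 n.
by move: (2 ^ n)%N => a; nia.
Qed.

Lemma Gamma2_mu x y : x != y -> ~~ Gamma2 x y ->
  #|common_nbrs (@Gamma2 n.+2) x y|%:Z *+ 4
  = (2 ^ n.+1 * (2 ^ n.+1 + 1) * 4)%N%:Z + sign_dot adj2 x y.
Proof. by move=> xy /negbTE G; rewrite -(Gamma2_common xy) G mul0rn addr0. Qed.

Lemma Gamma2_edge_regular :
  edge_regular (@Gamma2 n.+2) (2 ^ (2 * n.+2))%N
    ((2 ^ n.+1 + 1) * (2 ^ n.+2 - 1))%N (2 * (2 ^ n + 1) * (2 ^ n.+1 - 1))%N.
Proof.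
split.
- split=> [x y|x]; last by rewrite Gamma2E eqxx.
  by rewrite !Gamma2E eq_sym adj2_sym.
- exact: card_mat.
- exists 0, (delta_mx 0 l); apply: W1_clique.
  + by rewrite inE; apply/eqP/rowP => j; rewrite !mxE.
  + by rewrite inE; apply/eqP/rowP => j; rewrite !mxE.
  by apply/eqP => /matrixP/(_ 0 l); rewrite !mxE !eqxx => /eqP.
- exact: Gamma2_nbrs.
- exact: Gamma2_lambda.
Qed.

(** * The values for non-adjacent pairs *)

Definition mu_values : seq nat :=
  let mu := (2 ^ n.+1 * (2 ^ n.+1 + 1))%N in
  [:: mu - 2 ^ n.+1; mu; mu + 2 ^ n.+1]%N.

Lemma Gamma2_mu_sub x y : x != y -> ~~ Gamma2 x y ->
  #|common_nbrs (@Gamma2 n.+2) x y| \in mu_values.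
Proof.
move=> xy G; have := Gamma2_mu xy G; rewrite !inE.
case: (sign_dot_adj2 xy) => [|[_ []]] ->; rewrite !expnS; move: (2 ^ n)%N => a h;
  apply/or3P; [apply: Or32|apply: Or33|apply: Or31]; apply/eqP; nia.
Qed.

Lemma Gamma2_mu_attained m : m \in mu_values -> exists x y,
  [/\ x != y, ~~ Gamma2 x y & #|common_nbrs (@Gamma2 n.+2) x y| = m].
Proof.
have pl := negbTE p_neq_l.
have lp : (l == p) = false by rewrite eq_sym.
pose x : mat := delta_mx 0 l.
(* [x] lies in [V1], while [y b] lies in the translate of [W1] but outside [V2]. Their second rows
   differ in the last entry, so the inner product is nonzero, and [b], the entry in column [p],
   selects its sign. *)
pose y (b : bool) : mat := delta_mx 0 l + delta_mx 1 l + delta_mx 0 p *+ b.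
have y1l b : y b 1 l = 1 by rewrite !mxE !eqxx; case: b; rewrite !mxE; apply/eqP.
have y0l b : y b 0 l = 1 by rewrite !mxE !eqxx; case: b; rewrite !mxE ?lp; apply/eqP.
have y0p b : y b 0 p = b%:R by rewrite !mxE pl; case: b; rewrite !mxE ?eqxx; apply/eqP.
have ty b : tail0 (y b).
  apply/tail0P => j jl; rewrite !mxE (negbTE jl).
  by case: b; rewrite !mxE; apply/eqP.
have tx : tail0 x by apply/tail0P => j jl; rewrite !mxE.
have Vx : inV x by rewrite /inV tx !mxE !eqxx.
have Vy b : ~~ inV (y b) by rewrite /inV ty y0l y1l.
have xy b : same_tail x (y b).
  by apply/same_tailP => j jl; rewrite (tail0P _ tx) // (tail0P _ (ty b)).
have xNy b : x != y b by apply: contraNneq (Vy b) => <-.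
have Gxy b : ~~ Gamma2 x (y b).
  by rewrite Gamma2E xNy adj2_V // y1l !mxE.
have dot b : sign_dot adj2 x (y b) = (if b then - 2 else 2) * N%:Z.
  rewrite sign_dot_V // y1l y0p !mxE pl !eqxx /=.
  by case: b => /=; rewrite mulrA.
rewrite !inE => /or3P[] /eqP ->.
- exists x, (y true); split=> //.
  have := Gamma2_mu (xNy true) (Gxy true); rewrite dot !expnS.
  by move: (2 ^ n)%N => a h; nia.
(* The 1 in the second row at [p] separates the tails of 0 and [w], so the inner product is 0. The 1
   above it makes [Q w = 1], and neither switching affects this pair. *)
- pose w : mat := delta_mx 0 p + delta_mx 1 p.
  have w1p : w 1 p = 1 by rewrite !mxE !eqxx; apply/eqP.
  have ww : (0 : mat) != w.
    by apply/eqP => /matrixP/(_ 1 p); rewrite w1p mxE => /eqP.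
  have st : ~~ same_tail 0 w.
    by apply/same_tailPn; exists p; rewrite ?p_neq_l // w1p mxE.
  have G : ~~ Gamma2 0 w.
    have t0 : tail0 0 by apply/tail0P => j _; rewrite mxE.
    have V0 : inV 0 = false by rewrite /inV !mxE eqxx andbF.
    have C0 : inC 0 = false by rewrite /inC tail0_tailp.
    have tw : tail0 w = false.
      by apply/negP => /tail0P/(_ p p_neq_l); rewrite w1p => /eqP.
    rewrite Gamma2E ww /adj2 /adj1 /sw1 /sw2 V0 C0 tw andbF.
    rewrite /= addbF addbF sub0r QN /Q (bigD1 p) //= w1p big1 => [|j jp].
      by rewrite !mxE !eqxx.
    by rewrite !mxE (negbTE jp) !andbF addr0 mul0r.
  exists 0, w; split=> //.
  have := Gamma2_mu ww G; rewrite sign_dot_tail // !expnS.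
  by move: (2 ^ n)%N => a h; nia.
- exists x, (y false); split=> //.
  have := Gamma2_mu (xNy false) (Gxy false); rewrite dot !expnS.
  by move: (2 ^ n)%N => a h; nia.
Qed.

End PolarGraph.

Local Close Scope ring_scope.

Theorem theorem20 (e : nat) (he : 2 <= e) :
  let G := @Gamma2 e in
  let mu := 2 ^ (e - 1) * (2 ^ (e - 1) + 1) in
  [/\ strictly_Neumaier G,
      edge_regular G (2 ^ (2 * e))
        ((2 ^ (e - 1) + 1) * (2 ^ e - 1))
        (2 * (2 ^ (e - 2) + 1) * (2 ^ (e - 1) - 1)),
      exists S : {set 'M['F_2]_(2, e)},
        regular_clique G (2 ^ (e - 1)) S /\ #|S| = 2 ^ e
    & forall n : nat,
        (exists x y : 'M['F_2]_(2, e),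
          [/\ x != y, ~~ G x y & #|common_nbrs G x y| = n])
        <-> n \in [:: mu - 2 ^ (e - 1); mu; mu + 2 ^ (e - 1)]].
Proof.
case: e he => [|[|n]] // _ G mu.
rewrite {}/G {}/mu subn1 subn2 /=.
have er := Gamma2_edge_regular n.
have rc := W1_regular_clique n.
have attained := @Gamma2_mu_attained n.
(* This pair with value mu excludes completeness; together with a pair of value mu + 2^(e-1) it also
   excludes strong regularity. *)
have [|x [y [xy Gxy cxy]]] := attained (2 ^ n.+1 * (2 ^ n.+1 + 1))%N.
  by rewrite !inE eqxx orbT.
split=> //.
- split; [by do 3!eexists; exact: er| |by do 2!eexists; exact: rc|].
    by move=> /(_ _ _ xy); apply/negP.
  case=> _ _ [m mP].
  have [|x' [y' [xy' Gxy' cxy']]] :=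
    attained (2 ^ n.+1 * (2 ^ n.+1 + 1) + 2 ^ n.+1)%N.
    by rewrite !inE eqxx !orbT.
  have := mP _ _ xy Gxy; rewrite cxy -(mP _ _ xy' Gxy') cxy'.
  by have := expn_gt0 2 n.+1; lia.
- by exists (W1 n.+2); split=> //; exact: card_W1.
move=> m; split=> [[x' [y' [xy' Gxy' <-]]]|]; last exact: attained.
exact: Gamma2_mu_sub.
Qed.
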